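(* Let $\Sigma$ be a finite set of letters. The two-sorted algebra $\mathbf{UCF}$ of unordered forests and one-hole contexts over $\Sigma$ is simulated by the algebra $(\mathbb{Q}[x],+,\times)$.
   Context: Unordered forests. An unordered tree over $\Sigma$ is an unranked $\Sigma$-labelled finite tree in which the children of each node form a multiset (no order). An unordered forest is a finite multiset of unordered trees; $\emptyset$ is the empty forest. Operations on forests: $+$ is multiset union, and for $a\in\Sigma$, $\mathrm{root}_a(t_1+\dots+t_n)$ is the tree with root labelled $a$ and children $t_1,\dots,t_n$. $\mathbf{UCF}$. Let $\circ$ be a hole symbol that may be used as a leaf, in place of a tree. $\mathbf{UCF}$ is the two-sorted algebra whose elements of type $0$ are unordered forests (no $\circ$) and whose elements of type $1$ are unordered forests with exactly one occurrence of $\circ$ (contexts). Its operations are $+$ (on pairs of types $(0,0),(0,1),(1,0)$, so that at most one hole occurs in the result), $\mathrm{root}_a$ for $a\in\Sigma$ (on each type), and substitution $h[\circ:=g]$, replacing the hole (if any) of $h$ by $g$ (on every pair of types). An operation defined on several combinations of types is regarded as one typed operation for each combination. Polynomial functions. For an algebra with universe $B$, a polynomial function $B^k\to B$ is a function induced by a term built from variables, elements of $B$ as constants, and the operations of the algebra; a polynomial function $B^k\to B^n$ is an $n$-tuple of such functions. Simulation. An algebra with universe $A=\bigsqcup_i A_i$ (possibly multi-sorted) is simulated by an algebra with universe $B$ if there are $n\in\mathbb{N}$ and an injective map $\alpha:A\to B^n$ such that for every operation $\rho:A_{i_1}\times\dots\times A_{i_m}\to A_j$ there is a polynomial function $f:B^{m\times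 n}\to B^n$ with $\alpha(\rho(a_1,\dots,a_m))=f(\alpha(a_1),\dots,\alpha(a_m))$ for all $a_1\in A_{i_1},\dots,a_m\in A_{i_m}$. *)

(* Defs.v *)
From HB Require Import structures.
From mathcomp Require Import all_boot all_order all_algebra.
From mathcomp Require Import generic_quotient boolp.

Set Implicit Arguments.
Unset Strict Implicit.
Unset Printing Implicit Defensive.

Import GRing.Theory.

Record msalgebra := MSAlgebra {
  ms_sort : Type;
  ms_carrier : ms_sort -> Type;
  ms_op : Type;
  ms_arity : ms_op -> nat;
  ms_dom : forall o : ms_op, 'I_(ms_arity o) -> ms_sort;
  ms_cod : ms_op -> ms_sort;
  ms_interp : forall o : ms_op,
    (forall k : 'I_(ms_arity o), ms_carrier (ms_dom k)) -> ms_carrier (ms_cod o)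
}.

Definition ms_universe (A : msalgebra) : Type := {s : ms_sort A & ms_carrier s}.

Definition ms_inj (A : msalgebra) (s : ms_sort A) (a : ms_carrier s) :
  ms_universe A := Tagged (@ms_carrier A) a.

Record algebra := Algebra {
  alg_universe : Type;
  alg_op : Type;
  alg_arity : alg_op -> nat;
  alg_interp : forall o : alg_op,
    ('I_(alg_arity o) -> alg_universe) -> alg_universe
}.

Inductive pterm (B : algebra) (X : Type) : Type :=
| PVar of X
| PConst of alg_universe B
| POp (o : alg_op B) of ('I_(alg_arity o) -> pterm B X).

Fixpoint peval (B : algebra) (X : Type) (v : X -> alg_universe B)
    (t : pterm B X) : alg_universe B :=
  match t with
  | PVar x => v x
  | PConst b => b
  | POp o ts => alg_interp (fun k => peval v (ts k))
  end.

(* The finite index set X stands for the k of a function B^k -> B^n. *)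
Definition polynomial_function (B : algebra) (X : finType) (n : nat)
    (f : {ffun X -> alg_universe B} -> {ffun 'I_n -> alg_universe B}) : Prop :=
  exists t : 'I_n -> pterm B X, forall v j, f v j = peval v (t j).

Definition simulated_by (A : msalgebra) (B : algebra) : Prop :=
  exists (n : nat) (alpha : ms_universe A -> {ffun 'I_n -> alg_universe B}),
    injective alpha /\
    forall o : ms_op A,
      exists2 f : {ffun 'I_(ms_arity o) * 'I_n -> alg_universe B} ->
                  {ffun 'I_n -> alg_universe B},
        polynomial_function f &
        forall a : (forall k : 'I_(ms_arity o), ms_carrier (ms_dom k)),
          alpha (ms_inj (ms_interp a)) =
          f [ffun p => alpha (ms_inj (a p.1)) p.2].

Inductive ring_op := RAdd | RMul.

Definition ring_interp (R : pzRingType) (o : ring_op) (v : 'I_2 -> R) : R :=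
  match o with
  | RAdd => v ord0 + v ord_max
  | RMul => v ord0 * v ord_max
  end%R.

Definition ring_algebra (R : pzRingType) : algebra :=
  @Algebra R ring_op (fun=> 2) (@ring_interp R).

(* Forests are first presented as lists of ordered trees, with any number of
   holes, and then taken modulo reordering of siblings (uforest below). *)

Inductive otree (S : Type) : Type :=
| Hole
| Node of S & seq (otree S).

Arguments Hole {S}.

HB.instance Definition _ (S : Type) := gen_eqMixin (otree S).
HB.instance Definition _ (S : Type) := gen_choiceMixin (otree S).

Fixpoint otree_holes (S : Type) (t : otree S) : nat :=
  match t with
  | Hole => 1
  | Node _ c => sumn (map (@otree_holes S) c)
  end.

Definition oholes (S : Type) (f : seq (otree S)) : nat :=
  sumn (map (@otree_holes S) f).

(* A hole is replaced by a forest, which is spliced among its siblings. *)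
Fixpoint otree_subst (S : Type) (g : seq (otree S)) (t : otree S) :
    seq (otree S) :=
  match t with
  | Hole => g
  | Node a c => [:: Node a (flatten (map (otree_subst g) c))]
  end.

Definition osubst (S : Type) (h g : seq (otree S)) : seq (otree S) :=
  flatten (map (otree_subst g) h).

(* Equality up to reordering siblings, at every depth: the clauses are those
   of the inductive definition of permutations, with oeq_node also descending
   into the children. *)
Inductive oeq (S : Type) : seq (otree S) -> seq (otree S) -> Prop :=
| oeq_nil : oeq [::] [::]
| oeq_hole f g : oeq f g -> oeq (Hole :: f) (Hole :: g)
| oeq_node a c d f g :
    oeq c d -> oeq f g -> oeq (Node a c :: f) (Node a d :: g)
| oeq_swap t u f : oeq [:: t, u & f] [:: u, t & f]
| oeq_trans f g h : oeq f g -> oeq g h -> oeq f h.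

Section OrderedForests.
Variable S : Type.
Implicit Types f g h : seq (otree S).

Lemma otree_forest_ind (P : otree S -> Prop) (Q : seq (otree S) -> Prop) :
    P Hole -> (forall a c, Q c -> P (Node a c)) ->
    Q [::] -> (forall t f, P t -> Q f -> Q (t :: f)) ->
  (forall t, P t) /\ (forall f, Q f).
Proof.
move=> PH PN Q0 QS.
have Pt : forall t, P t.
  fix IH 1 => -[|a c]; first exact: PH.
  by apply: PN; elim: c => [|t c IHc]; [exact: Q0 | apply: QS].
by split=> //; elim=> [|t f Qf]; [exact: Q0 | apply: QS].
Qed.

Lemma oeq_refl f : oeq f f.
Proof.
suff [_ H] : (forall t f, oeq f f -> oeq (t :: f) (t :: f)) /\
              (forall f, oeq f f) by exact: H.
apply: otree_forest_ind => [g gg|a c cc g gg||t g tg gg].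
- exact: oeq_hole.
- exact: oeq_node.
- exact: oeq_nil.
- exact: tg.
Qed.

Lemma oeq_cons t f g : oeq f g -> oeq (t :: f) (t :: g).
Proof.
by case: t => [|a c] fg; [apply: oeq_hole | apply: oeq_node fg; apply: oeq_refl].
Qed.

Lemma oeq_sym f g : oeq f g -> oeq g f.
Proof.
elim=> {f g} [|f g _ gf|a c d f g _ dc _ gf|t u f|f g h _ gf _ hg].
- exact: oeq_nil.
- exact: oeq_hole.
- exact: oeq_node.
- exact: oeq_swap.
- exact: oeq_trans hg gf.
Qed.

Lemma oeq_catl f g h : oeq g h -> oeq (f ++ g) (f ++ h).
Proof. by move=> gh; elim: f => //= t f; apply: oeq_cons. Qed.

Lemma oeq_catr f g h : oeq f g -> oeq (f ++ h) (g ++ h).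
Proof.
elim=> {f g} /= [|f g _ fg|a c d f g cd _ _ fg|t u f|f g k _ fg _ gk].
- exact: oeq_refl.
- exact: oeq_hole.
- exact: oeq_node.
- exact: oeq_swap.
- exact: oeq_trans fg gk.
Qed.

Lemma oeq_cat f f' g g' : oeq f f' -> oeq g g' -> oeq (f ++ g) (f' ++ g').
Proof.
by move=> ff' gg'; apply: oeq_trans (oeq_catr _ ff') (oeq_catl _ gg').
Qed.

Lemma oeq_catC f g : oeq (f ++ g) (g ++ f).
Proof.
elim: f => [|t f IHf] /=; first by rewrite cats0; apply: oeq_refl.
apply: oeq_trans (oeq_cons t IHf) _.
elim: g {IHf} => [|u g IHg] /=; first exact: oeq_refl.
exact: oeq_trans (oeq_swap _ _ _) (oeq_cons u IHg).
Qed.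

Lemma oeq_holes f g : oeq f g -> oholes f = oholes g.
Proof.
rewrite /oholes; elim=> {f g} //= [f g _ ->|a c d f g _ -> _ ->|t u f|f g h _ ->] //.
exact: addnCA.
Qed.

Lemma oeq_substl h h' g : oeq h h' -> oeq (osubst h g) (osubst h' g).
Proof.
rewrite /osubst.
elim=> {h h'} /= [|h h' _ IH|a c d h h' _ IHc _ IH|t u h|h1 h2 h3 _ IH1 _ IH2].
- exact: oeq_nil.
- exact: oeq_catl.
- exact: oeq_node.
- by rewrite !catA; apply/oeq_catr/oeq_catC.
- exact: oeq_trans IH1 IH2.
Qed.

Lemma oeq_substr h g g' : oeq g g' -> oeq (osubst h g) (osubst h g').
Proof.
move=> gg'.
suff [_ H] : (forall t, oeq (otree_subst g t) (otree_subst g' t)) /\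
              (forall h, oeq (osubst h g) (osubst h g')) by exact: H.
apply: otree_forest_ind => [|a c IHc||t f IHt IHf] //=.
- by apply: oeq_node => //; apply: oeq_nil.
- exact: oeq_nil.
- exact: oeq_cat.
Qed.

Lemma oholes_cat f g : oholes (f ++ g) = oholes f + oholes g.
Proof. by rewrite /oholes map_cat sumn_cat. Qed.

Lemma oholes_subst h g : oholes (osubst h g) = oholes h * oholes g.
Proof.
suff [_ H] : (forall t, oholes (otree_subst g t) = otree_holes t * oholes g) /\
              (forall h, oholes (osubst h g) = oholes h * oholes g) by exact: H.
apply: otree_forest_ind => [|a c IHc||t f IHt IHf] //=.
- by rewrite mul1n.
- by rewrite {1}/oholes /= addn0.
- by rewrite /osubst /= oholes_cat IHt IHf -mulnDl.
Qed.

End OrderedForests.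

Section UnorderedForests.
Variable S : Type.

Definition oeqb : rel (seq (otree S)) := fun f g => `[< oeq f g >].

Lemma oeqb_refl : reflexive oeqb.
Proof. by move=> f; apply/asboolP/oeq_refl. Qed.

Lemma oeqb_sym : symmetric oeqb.
Proof. by move=> f g; apply/asboolP/asboolP; apply: oeq_sym. Qed.

Lemma oeqb_trans : transitive oeqb.
Proof.
by move=> g f h /asboolP fg /asboolP gh; apply/asboolP; apply: oeq_trans fg gh.
Qed.

Canonical oeqb_equiv := EquivRel oeqb oeqb_refl oeqb_sym oeqb_trans.

Local Open Scope quotient_scope.

Definition uforest := {eq_quot oeqb}.

HB.instance Definition _ := Choice.on uforest.
HB.instance Definition _ : EqQuotient _ oeqb uforest := EqQuotient.on uforest.

Definition upi (f : seq (otree S)) : uforest := \pi_uforest f.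

Definition uholes (f : uforest) : nat := oholes (repr f).
Definition uadd (f g : uforest) : uforest := upi (repr f ++ repr g).
Definition uroot (a : S) (f : uforest) : uforest := upi [:: Node a (repr f)].
Definition usubst (h g : uforest) : uforest := upi (osubst (repr h) (repr g)).

Lemma upiP f g : upi f = upi g <-> oeq f g.
Proof.
split=> [/eqmodP/asboolP//|fg].
by apply/eqmodP/asboolP.
Qed.

Lemma uforestP (f : uforest) : exists g, f = upi g.
Proof. by exists (repr f); rewrite /upi reprK. Qed.

Lemma oeq_repr f : oeq (repr (upi f)) f.
Proof. by apply/upiP; rewrite /upi reprK. Qed.

Lemma uholes_pi f : uholes (upi f) = oholes f.
Proof. exact/oeq_holes/oeq_repr. Qed.

Lemma uadd_pi f g : uadd (upi f) (upi g) = upi (f ++ g).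
Proof. by apply/upiP/oeq_cat; apply: oeq_repr. Qed.

Lemma uroot_pi a f : uroot a (upi f) = upi [:: Node a f].
Proof. by apply/upiP/oeq_node; [apply: oeq_repr | apply: oeq_nil]. Qed.

Lemma usubst_pi h g : usubst (upi h) (upi g) = upi (osubst h g).
Proof.
apply/upiP; apply: oeq_trans (oeq_substl _ (oeq_repr h)) _.
exact/oeq_substr/oeq_repr.
Qed.

Lemma uholes_add f g : uholes (uadd f g) = uholes f + uholes g.
Proof. by rewrite uholes_pi oholes_cat. Qed.

Lemma uholes_root a f : uholes (uroot a f) = uholes f.
Proof. by rewrite uholes_pi /oholes /= addn0. Qed.

Lemma uholes_subst h g : uholes (usubst h g) = uholes h * uholes g.
Proof. by rewrite uholes_pi oholes_subst. Qed.

(* The sorts 0 and 1 are false and true, coerced to nat. *)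
Definition ucf_carrier (s : bool) : Type := {f : uforest | uholes f == s}.

(* The side condition of UPlus leaves the sorts (0,0), (0,1) and (1,0). *)
Inductive ucf_op : Type :=
| UPlus (s t : bool) of ~~ (s && t)
| URoot (a : S) (s : bool)
| USubst (s t : bool).

Definition ucf_arity (o : ucf_op) : nat :=
  match o with UPlus _ _ _ => 2 | URoot _ _ => 1 | USubst _ _ => 2 end.

Definition ucf_dom (o : ucf_op) : 'I_(ucf_arity o) -> bool :=
  match o with
  | UPlus s t _ => fun k => nth s [:: s; t] k
  | URoot _ s => fun=> s
  | USubst s t => fun k => nth s [:: s; t] k
  end.

Definition ucf_cod (o : ucf_op) : bool :=
  match o with UPlus s t _ => s || t | URoot _ s => s | USubst s t => s && t end.

Lemma ucf_plus_subproof (s t : bool) (st : ~~ (s && t))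
    (f : ucf_carrier s) (g : ucf_carrier t) :
  uholes (uadd (val f) (val g)) == s || t.
Proof.
rewrite uholes_add (eqP (valP f)) (eqP (valP g)).
by case: s t st {f g} => [] [].
Qed.

Definition ucf_plus (s t : bool) (st : ~~ (s && t))
    (f : ucf_carrier s) (g : ucf_carrier t) : ucf_carrier (s || t) :=
  exist _ (uadd (val f) (val g)) (ucf_plus_subproof st f g).

Lemma ucf_root_subproof (a : S) (s : bool) (f : ucf_carrier s) :
  uholes (uroot a (val f)) == s.
Proof. by rewrite uholes_root (valP f). Qed.

Definition ucf_root (a : S) (s : bool) (f : ucf_carrier s) : ucf_carrier s :=
  exist _ (uroot a (val f)) (ucf_root_subproof a f).

Lemma ucf_subst_subproof (s t : bool) (h : ucf_carrier s) (g : ucf_carrier t) :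
  uholes (usubst (val h) (val g)) == s && t.
Proof. by rewrite uholes_subst (eqP (valP h)) (eqP (valP g)) mulnb. Qed.

Definition ucf_subst (s t : bool) (h : ucf_carrier s) (g : ucf_carrier t) :
    ucf_carrier (s && t) :=
  exist _ (usubst (val h) (val g)) (ucf_subst_subproof h g).

Definition ucf_interp (o : ucf_op) :
    (forall k : 'I_(ucf_arity o), ucf_carrier (ucf_dom k)) ->
    ucf_carrier (ucf_cod o) :=
  match o with
  | UPlus s t st => fun v => ucf_plus st (v ord0) (v ord_max)
  | URoot a s => fun v => ucf_root a (v ord0)
  | USubst s t => fun v => ucf_subst (v ord0) (v ord_max)
  end.

Definition UCF : msalgebra :=
  @MSAlgebra bool ucf_carrier ucf_op ucf_arity ucf_dom ucf_cod ucf_interp.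

End UnorderedForests.

(* Main.v *)
(* Send a forest to the product of the polynomials of its trees, and the tree
   with root [a] over a forest of polynomial p to p X + c_a, for distinct
   integers c_a congruent to 2 modulo 4. Every tree polynomial is monic and
   irreducible by Eisenstein's criterion at 2, and its constant coefficient
   determines the root, so unique factorization makes this map injective.
   Evaluating with a polynomial y in place of the hole, a one-hole context acts
   as an affine function of y, so its values at y = 0 and y = 1 suffice to
   compute substitutions. They also give the value at y = X + 2, where the hole
   behaves as a tree distinct from all others, hence they determine the
   context. *)
Require Import Defs.
From mathcomp Require Import all_boot all_order all_algebra.
From mathcomp Require Import boolp generic_quotient zify ring.

Set Implicit Arguments.
Unset Strict Implicit.
Unset Printing Implicit Defensive.

Import GRing.Theory.
Local Open Scope ring_scope.

(** * Irreducible polynomials over integral domains *)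

Lemma irreducible_poly_dvdM (A : idomainType) (p q r : {poly A}) :
  irreducible_poly p -> (p %| q * r) = (p %| q) || (p %| r).
Proof.
move=> irr_p; apply/idP/orP => [|[]]; last 2 first.
- exact: dvdp_mulr.
- exact: dvdp_mull.
(* Here [%|] is divisibility up to a nonzero scalar, so Gauss's lemma for coprime polynomials
   applies over any integral domain. *)
have [pq|pNq] := boolP (p %| q); first by left.
by rewrite Pdiv.Idomain.Gauss_dvdpr ?irreducible_poly_coprime //; right.
Qed.

Lemma monic_mulX_addC (R : nzRingType) (p : {poly R}) c :
  p \is monic -> p * 'X + c%:P \is monic.
Proof.
move=> p_mon; rewrite monicE lead_coefDl ?lead_coefMX ?(monicP p_mon) //.
rewrite size_mulX ?monic_neq0 // ltnS (leq_trans (size_polyC_leq1 c)) //.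
by rewrite size_poly_gt0 monic_neq0.
Qed.

(** Reducing to a power of ['X] says that [p] divides every lower coefficient, in a form stable
    under products and hence suited to induction on forests. *)
Lemma eisenstein_monic (p n : nat) (q : {poly int}) : prime p ->
  q \is monic -> map_poly intr q = 'X^(n.+1) :> {poly 'F_p} ->
  ~~ (p ^+ 2 %| q`_0)%Z -> irreducible_poly q.
Proof.
move=> p_prime q_mon q_modp q0.
have sz_q : size q = n.+2.
  rewrite -(size_polyXn 'F_p n.+1) -q_modp size_map_poly_id0 //.
  by rewrite (monicP q_mon) rmorph1 oner_neq0.
apply: (eisenstein_crit p_prime) => //.
- by rewrite sz_q.
- by rewrite (monicP q_mon) (dvdz_pcharf (pchar_Fp p_prime)) oner_neq0.
- move=> i; rewrite sz_q (dvdz_pcharf (pchar_Fp p_prime)) -coef_map q_modp.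
  by rewrite coefXn /= => /ltn_eqF ->.
Qed.

(** * Polynomials of ordered forests *)

Section ForestPoly.
Variable S : finType.
Implicit Types (t u : otree S) (f g h : seq (otree S)) (y : {poly int}).

(** Starting at 6 keeps 2, which has the same residue modulo 4, free for the hole. *)
Definition root_coef (a : S) : nat := (4 * enum_rank a + 6)%N.

Fixpoint tree_poly y t : {poly int} :=
  match t with
  | Hole => y
  | Node a c => foldr *%R 1 (map (tree_poly y) c) * 'X + (root_coef a)%:Z%:P
  end.

(** This is literally the product inside [tree_poly], so the two unfold into each other by
    conversion. *)
Definition forest_poly y f : {poly int} := foldr *%R 1 (map (tree_poly y) f).

Lemma forest_poly_cat y f g :
  forest_poly y (f ++ g) = forest_poly y f * forest_poly y g.
Proof.
by elim: f => [|t f IHf] /=; rewrite ?mul1r // /forest_poly /= -mulrA -IHf.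
Qed.

Lemma forest_poly_oeq y f g : oeq f g -> forest_poly y f = forest_poly y g.
Proof.
rewrite /forest_poly; elim=> {f g} //= [f g _ ->|a c d f g _ -> _ ->|t u f|f g h _ ->] //.
exact: mulrCA.
Qed.

Lemma forest_poly_subst y h g :
  forest_poly y (osubst h g) = forest_poly (forest_poly y g) h.
Proof.
set z := forest_poly y g.
suff [_ H] : (forall t, forest_poly y (otree_subst g t) = tree_poly z t) /\
             (forall h, forest_poly y (osubst h g) = forest_poly z h) by exact: H.
apply: otree_forest_ind => [|a c IHc||t f IHt IHf] //=.
- by rewrite {1}/forest_poly /= mulr1 -!/(forest_poly _ _) -IHc.
- by rewrite forest_poly_cat IHt IHf.
Qed.

Lemma forest_poly_no_hole y f : oholes f = 0%N -> forest_poly y f = forest_poly 0 f.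
Proof.
suff [_ H] : (forall t, otree_holes t = 0%N -> tree_poly y t = tree_poly 0 t) /\
    (forall f, oholes f = 0%N -> forest_poly y f = forest_poly 0 f) by exact: H.
apply: otree_forest_ind => [|a c IHc||t {}f IHt IHf] //=.
- by move/IHc; rewrite /forest_poly => ->.
- move/eqP; rewrite addn_eq0 => /andP[/eqP t0 /eqP f0].
  by rewrite /forest_poly /= IHt // -!/(forest_poly _ _) IHf.
Qed.

(** With at most one hole, at most one factor of each product depends on [y]. *)
Lemma forest_poly_affine y f : (oholes f <= 1)%N ->
  forest_poly y f = forest_poly 0 f + y * (forest_poly 1 f - forest_poly 0 f).
Proof.
suff [_ H] : (forall t, (otree_holes t <= 1)%N ->
      tree_poly y t = tree_poly 0 t + y * (tree_poly 1 t - tree_poly 0 t)) /\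
    (forall f, (oholes f <= 1)%N ->
      forest_poly y f = forest_poly 0 f + y * (forest_poly 1 f - forest_poly 0 f)).
  exact: H.
apply: otree_forest_ind => [|a c IHc||t {}f IHt IHf] /=.
- by move=> _; rewrite subr0 mulr1 add0r.
- by move/IHc; rewrite -!/(forest_poly _ _) => ->; ring.
- by move=> _; rewrite subrr mulr0 addr0.
- rewrite /oholes /= -/(oholes f) => holes_tf.
  have consE z : forest_poly z (t :: f) = tree_poly z t * forest_poly z f by [].
  rewrite !consE IHt ?IHf; try lia.
  have [f0|t0] : oholes f = 0%N \/ otree_holes t = 0%N by lia.
    by rewrite (forest_poly_no_hole 1 f0); ring.
  have -> : tree_poly 1 t = tree_poly 0 t.
    have := @forest_poly_no_hole 1 [:: t].
    by rewrite /oholes /forest_poly /= addn0 !mulr1; apply.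
  ring.
Qed.

(* The hole becomes the tree p X + 2 with p = 1, like a leaf whose root has a
   coefficient that is not used by any letter. *)
Let y0 : {poly int} := 'X + 2%:P.

Lemma tree_poly_coef0 t :
  (tree_poly y0 t)`_0 = (if t is Node a _ then root_coef a else 2)%:Z.
Proof.
case: t => [|a c] /=; first by rewrite coefD coefX coefC add0r.
by rewrite coefD coefMX coefC add0r.
Qed.

(** The root constants are even, so modulo 2 a root only multiplies by ['X]. For forests the
    exponent may be 0, because of the empty product. *)
Lemma tree_poly_Eisenstein t : tree_poly y0 t \is monic /\
  exists n, map_poly intr (tree_poly y0 t) = 'X^(n.+1) :> {poly 'F_2}.
Proof.
have even0 n : ~~ odd n -> n%:Z%:~R = 0 :> 'F_2.
  by move=> n2; apply/eqP; rewrite -(dvdz_pcharf (pchar_Fp (isT : prime 2))) dvdzE dvdn2.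
have root (p : {poly int}) k n : p \is monic ->
    map_poly intr p = 'X^n :> {poly 'F_2} -> ~~ odd k ->
    p * 'X + k%:Z%:P \is monic /\
    exists n, map_poly intr (p * 'X + k%:Z%:P) = 'X^(n.+1) :> {poly 'F_2}.
  move=> p_mon p2 k2; split; first exact: monic_mulX_addC.
  by exists n; rewrite rmorphD rmorphM /= map_polyX map_polyC /= even0 // addr0 p2 -exprSr.
suff [H _] : (forall t, tree_poly y0 t \is monic /\
      exists n, map_poly intr (tree_poly y0 t) = 'X^(n.+1) :> {poly 'F_2}) /\
    (forall f, forest_poly y0 f \is monic /\
      exists n, map_poly intr (forest_poly y0 f) = 'X^n :> {poly 'F_2}).
  exact: H.
apply: otree_forest_ind => [|a c [c_mon [n cE]]||u f [u_mon [m uE]] [f_mon [n fE]]] /=.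
- have := @root 1 2 0; rewrite mul1r; apply=> //; first exact: monic1.
  by rewrite rmorph1.
- by apply: root cE _ => //; rewrite /root_coef oddD oddM.
- by split; [exact: monic1 | exists 0; rewrite /forest_poly /= rmorph1].
- split; first exact: rpredM u_mon f_mon.
  by exists (m.+1 + n)%N; rewrite /forest_poly /= rmorphM /= uE -/(forest_poly _ _) fE exprD.
Qed.

Lemma tree_poly_monic t : tree_poly y0 t \is monic.
Proof. by have [] := tree_poly_Eisenstein t. Qed.

Lemma tree_poly_irreducible t : irreducible_poly (tree_poly y0 t).
Proof.
have [t_mon [n tE]] := tree_poly_Eisenstein t.
apply: (eisenstein_monic (isT : prime 2)) tE _ => //.
by rewrite tree_poly_coef0 dvdzE; case: t {t_mon} => [|a c] //=; rewrite /root_coef; lia.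
Qed.

(** Irreducible polynomials are prime; the splitting of [f] exposes the factor to be cancelled. *)
Lemma dvdp_forest_poly (p : {poly int}) f :
    irreducible_poly p -> p %| forest_poly y0 f ->
  exists f1 t f2, f = f1 ++ t :: f2 /\ p %| tree_poly y0 t.
Proof.
move=> irr_p; elim: f => [|t f IHf].
  by rewrite dvdp1 => /eqP sz_p; case: irr_p; rewrite sz_p.
rewrite irreducible_poly_dvdM // => /orP[pt|/IHf [f1 [u [f2 [-> pu]]]]].
  by exists [::], t, f.
by exists (t :: f1), u, f2.
Qed.

(** The polynomial of the first tree on the left must be that of some tree on the right. Induction
    identifies these two trees and, after cancellation, the remaining forests. *)
Lemma forest_poly_inj f g : forest_poly y0 f = forest_poly y0 g -> oeq f g.
Proof.
move: f g.
suff [_ H] : (forall t u, tree_poly y0 t = tree_poly y0 u -> oeq [:: t] [:: u]) /\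
    (forall f g, forest_poly y0 f = forest_poly y0 g -> oeq f g) by exact: H.
apply: otree_forest_ind => [u|a c IHc u|g|t f IHt IHf g] E.
- have := congr1 (fun p : {poly int} => p`_0) E; rewrite !tree_poly_coef0.
  case: u {E} => [_|a c []]; first exact: oeq_refl.
  rewrite /root_coef; lia.
- have := congr1 (fun p : {poly int} => p`_0) E; rewrite !tree_poly_coef0.
  case: u E => [_ []|b d /= E []]; first by rewrite /root_coef; lia.
  move=> /addIn/eqP; rewrite eqn_mul2l /= => /eqP/val_inj/enum_rank_inj ab.
  rewrite -ab in E *; apply: oeq_node (oeq_nil _); apply: IHc.
  exact: (mulIf (monic_neq0 (monicX _))) (addIr _ E).
(* An irreducible tree polynomial cannot divide the empty product 1. *)
- have : forest_poly y0 g %| 1 by rewrite -E dvdpp.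
  case: g {E} => [_|u g ug1]; first exact: oeq_refl.
  have [] := tree_poly_irreducible u; have: tree_poly y0 u %| 1.
    by apply: dvdp_trans ug1; apply: dvdp_mulr.
  by rewrite dvdp1 => /eqP ->.
- have tg : tree_poly y0 t %| forest_poly y0 g by rewrite -E dvdp_mulr.
  have irr_t := tree_poly_irreducible t.
  have [g1 [u [g2 [gE tu]]]] := dvdp_forest_poly irr_t tg.
  have {}tu : tree_poly y0 t = tree_poly y0 u.
    (* Associates agree up to scalars, and monicity turns this into equality. *)
    apply/eqP; rewrite -eqp_monic ?tree_poly_monic //.
    apply: (tree_poly_irreducible u).2 tu.
    by case: irr_t => sz_t _; rewrite neq_ltn sz_t orbT.
  have {}E : forest_poly y0 f = forest_poly y0 (g1 ++ g2).
    apply: (mulfI (monic_neq0 (tree_poly_monic t))).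
    by rewrite [LHS]E gE !forest_poly_cat tu [LHS]mulrCA.
  rewrite gE; apply: oeq_trans (oeq_cat (IHt u tu) (IHf _ E)) _.
  (* The matched tree [u] moves from the front to its place between [g1] and [g2]. *)
  by rewrite -cat_rcons -cats1 catA; apply/oeq_catr/oeq_catC.
Qed.

End ForestPoly.

(** * Terms over a ring *)

Section RingTerms.
Variables (R : pzRingType) (X : Type).

Definition padd (s t : pterm (ring_algebra R) X) : pterm (ring_algebra R) X :=
  @POp (ring_algebra R) X RAdd (fun k : 'I_2 => if k == ord0 then s else t).

Definition pmul (s t : pterm (ring_algebra R) X) : pterm (ring_algebra R) X :=
  @POp (ring_algebra R) X RMul (fun k : 'I_2 => if k == ord0 then s else t).

Definition pconst (b : R) : pterm (ring_algebra R) X :=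
  @PConst (ring_algebra R) X b.

End RingTerms.

(** * Polynomials of unordered forests *)

Section UForestPoly.
Variable S : finType.
Implicit Types (f g h : uforest S) (y : {poly int}).

Definition uforest_poly y f : {poly int} := forest_poly y (repr f).

Lemma uforest_poly_pi y (f : seq (otree S)) : uforest_poly y (upi f) = forest_poly y f.
Proof. exact/forest_poly_oeq/oeq_repr. Qed.

Lemma uforest_poly_add y f g :
  uforest_poly y (uadd f g) = uforest_poly y f * uforest_poly y g.
Proof. by rewrite uforest_poly_pi forest_poly_cat. Qed.

Lemma uforest_poly_root y a f :
  uforest_poly y (uroot a f) = uforest_poly y f * 'X + (root_coef a)%:Z%:P.
Proof. by rewrite uforest_poly_pi /forest_poly /= mulr1. Qed.

Lemma uforest_poly_affine y f : (uholes f <= 1)%N ->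
  uforest_poly y f = uforest_poly 0 f + y * (uforest_poly 1 f - uforest_poly 0 f).
Proof. exact: forest_poly_affine. Qed.

(** Substitution evaluates [h] at the value of [g]; the affine form makes the result polynomial in
    the stored values. *)
Lemma uforest_poly_subst y h g : (uholes h <= 1)%N ->
  uforest_poly y (usubst h g) =
  uforest_poly 0 h + uforest_poly y g * (uforest_poly 1 h - uforest_poly 0 h).
Proof.
by move=> h1; rewrite uforest_poly_pi forest_poly_subst; apply: uforest_poly_affine.
Qed.

Lemma uforest_poly_inj01 f g : (uholes f <= 1)%N -> (uholes g <= 1)%N ->
  uforest_poly 0 f = uforest_poly 0 g -> uforest_poly 1 f = uforest_poly 1 g ->
  f = g.
Proof.
move=> f1 g1 fg0 fg1; rewrite -[f]reprK -[g]reprK; apply/upiP/forest_poly_inj.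
(* Both sides are values at ['X + 2], recovered from those at 0 and 1. *)
apply: etrans (uforest_poly_affine _ f1) _; rewrite fg0 fg1; apply/esym.
exact: uforest_poly_affine.
Qed.

End UForestPoly.

(** * Simulation by explicit terms *)

Lemma simulated_by_terms (A : msalgebra) (B : algebra) (n : nat)
    (alpha : ms_universe A -> {ffun 'I_n -> alg_universe B}) :
    injective alpha ->
    (forall o : ms_op A, exists t : 'I_n -> pterm B ('I_(ms_arity o) * 'I_n),
      forall (a : forall k : 'I_(ms_arity o), ms_carrier (ms_dom k)) j,
        alpha (ms_inj (ms_interp a)) j =
        peval (fun p => alpha (ms_inj (a p.1)) p.2) (t j)) ->
  simulated_by A B.
Proof.
move=> alpha_inj terms; exists n, alpha; split=> // o; have [t tE] := terms o.
exists (fun v => [ffun j => peval v (t j)]).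
  by exists t => v j; rewrite ffunE.
move=> a; apply/ffunP => j; rewrite tE [RHS]ffunE; congr peval.
by apply: funext => p; rewrite ffunE.
Qed.

Theorem theorem7 (Sigma : finType) :
  simulated_by (UCF Sigma) (ring_algebra {poly rat}).
Proof.
(* Injectivity was proved over the integers; this embedding carries it to rational coefficients. *)
pose pZtoQ : {poly int} -> {poly rat} := map_poly intr.
have pZtoQ_inj : injective pZtoQ by apply: map_inj_poly => //; apply: intr_inj.
pose alpha (x : ms_universe (UCF Sigma)) : {ffun 'I_2 -> {poly rat}} :=
  [ffun j : 'I_2 => pZtoQ (uforest_poly (nat_of_ord j)%:R (val (tagged x)))].
have sort_le1 (s : bool) (f : ucf_carrier Sigma s) : (uholes (val f) <= 1)%N.
  by rewrite (eqP (valP f)) leq_b1.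
apply: (@simulated_by_terms _ (ring_algebra {poly rat}) 2 alpha).
  move=> [s f] [s' f'] /ffunP E.
  have := E ord0; have := E ord_max; rewrite !ffunE /= => /pZtoQ_inj E1 /pZtoQ_inj E0.
  have ff' := uforest_poly_inj01 (sort_le1 s f) (sort_le1 s' f') E0 E1.
  (* The sort is the number of holes of the common forest. *)
  have ss' : s = s'.
    by apply: (can_inj oddb); rewrite -(eqP (valP f)) -(eqP (valP f')) ff'.
  by case: s' / ss' f' ff' {E E0 E1} => f' ff'; congr existT; apply: val_inj.
pose var n (k : 'I_n) (j : 'I_2) : pterm (ring_algebra {poly rat}) ('I_n * 'I_2) :=
  PVar (ring_algebra {poly rat}) (k, j).
case=> [s s' ss'|a s|s s'].
- exists (fun j => pmul (@var 2 ord0 j) (@var 2 ord_max j)).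
  by move=> v j /=; rewrite !ffunE /= uforest_poly_add [LHS]rmorphM.
- exists (fun j => padd
    (pmul (@var 1 ord0 j) (pconst _ 'X)) (pconst _ (root_coef a)%:~R%:P)).
  move=> v j /=; rewrite !ffunE /= uforest_poly_root [LHS]rmorphD rmorphM /=.
  by rewrite map_polyX map_polyC.
(* Subtraction is not an operation of the algebra, so the constant -1 is used. *)
- exists (fun j => padd (@var 2 ord0 ord0) (pmul (@var 2 ord_max j)
    (padd (@var 2 ord0 ord_max) (pmul (pconst _ (- 1)) (@var 2 ord0 ord0))))).
  move=> v j /=; rewrite !ffunE /= uforest_poly_subst ?sort_le1 //.
  by rewrite [LHS]rmorphD rmorphM rmorphB /= mulN1r.
Qed.
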